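(* Let $n=2$ and let $\mathcal D$ be a permutation-invariant probability distribution on payoffs of bimatrix games. Then for every NE approximator $f$ that is player-permutation-equivariant (PPE), $$\mathbb E_{u\sim\mathcal D}[\mathcal E((\mathcal Of)(u),u)]\ \le\ \mathbb E_{u\sim\mathcal D}[\mathcal E(f(u),u)].$$
   Context: There are $n=2$ players with finite action sets $\mathcal A_i=\{1,\dots,m_i\}$; $\mathcal A=\mathcal A_1\times\mathcal A_2$. A payoff is $u=(u_1,u_2)$ with $u_i:\mathcal A\to[0,1]$; $\mathcal U$ is the set of all payoffs. A product strategy is $\sigma=(\sigma_1,\sigma_2)$ with $\sigma_i\in\Delta\mathcal A_i$; $u_i(\sigma)=\sum_{a}\sigma_1(a_1)\sigma_2(a_2)u_i(a)$. The (Nash) equilibrium approximation is $\mathcal E(\sigma,u)=\max_{i\in\{1,2\}}\big(\max_{a_i\in\mathcal A_i}u_i(a_i,\sigma_{-i})-u_i(\sigma)\big)$. An NE approximator is a (tacitly measurable) map $f:\mathcal U\to\Delta\mathcal A_1\times\Delta\mathcal A_2$, with $f(u)_i$ player $i$'s strategy (outputs need not be equilibria). Permutations: $\mathcal G_i$ is the group of all bijections $\rho_i:\mathcal A_i\to\mathcal A_i$. $\rho_iu$ is the payoff with $(\rho_iu)_j(a_i,a_{-i})=u_j(\rho_i^{-1}(a_i),a_{-i})$ for all $j$; $(\rho_i\sigma_i)(a_i)=\sigma_i(\rho_i^{-1}(a_i))$. $\mathcal D$ is permutation-invariant if for every $i$ and $\rho_i\in\mathcal G_i$, $u\sim\mathcal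 D$ implies $\rho_iu\sim\mathcal D$. $f$ is PPE if $f(\rho_iu)_i=\rho_if(u)_i$ for all $i$, $\rho_i\in\mathcal G_i$ and $u\in\mathcal U$. Orbit averaging: $(\mathcal O_if)(u)_i=f(u)_i$ and $(\mathcal O_if)(u)_j=\frac1{|\mathcal A_i|!}\sum_{\rho_i\in\mathcal G_i}f(\rho_iu)_j$ for $j\ne i$; $\mathcal O=\mathcal O_1\circ\mathcal O_2$. *)

(* Defs.v *)
From HB Require Import structures.
From mathcomp Require Import all_boot all_order all_algebra all_fingroup.
From mathcomp Require Import all_classical all_reals all_analysis.

Set Implicit Arguments.
Unset Strict Implicit.
Unset Printing Implicit Defensive.

Import Order.TTheory GRing.Theory Num.Theory.

Local Open Scope ring_scope.

Definition player := 'I_2.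
Definition player1 : player := ord0.
Definition player2 : player := ord_max.

(* Player i has (m i).+1 actions, so that action sets are nonempty. *)
Notation action m i := 'I_(m i).+1.

Definition finmax (R : realType) (n : nat) (F : 'I_n.+1 -> R) : R :=
  \big[Num.max/F ord0]_(k < n.+1) F k.

Section Strategy.
Context {R : realType} {T : finType}.

Record strategy := Strategy {
  strategy_val :> {ffun T -> R};
  _ : [forall a, 0 <= strategy_val a] && (\sum_a strategy_val a == 1)
}.

HB.instance Definition _ := [isSub for strategy_val].
HB.instance Definition _ := [Choice of strategy by <:].

Lemma strategy_ge0 (s : strategy) a : 0 <= s a.
Proof. by have /andP[/forallP s0 _] := valP s; exact: s0. Qed.

Lemma strategy_sum1 (s : strategy) : \sum_a s a = 1.
Proof. by have /andP[_ /eqP] := valP s. Qed.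

Fact pure_strategy_subproof (b : T) (p := [ffun a => (a == b)%:R : R]) :
  [forall a, 0 <= p a] && (\sum_a p a == 1).
Proof.
apply/andP; split; first by apply/forallP => a; rewrite ffunE ler0n.
rewrite (bigD1 b) //= ffunE eqxx big1 ?addr0 // => a ab.
by rewrite ffunE (negbTE ab).
Qed.

Definition pure_strategy (b : T) : strategy := Strategy (pure_strategy_subproof b).

Fact perm_strategy_subproof (rho : {perm T}) (s : strategy)
    (p := [ffun a => s ((rho^-1)%g a)]) :
  [forall a, 0 <= p a] && (\sum_a p a == 1).
Proof.
apply/andP; split.
  by apply/forallP => a; rewrite ffunE strategy_ge0.
rewrite (reindex_inj (@perm_inj _ rho)) /= -(strategy_sum1 s).
by apply/eqP/eq_bigr => a _; rewrite ffunE permK.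
Qed.

Definition perm_strategy (rho : {perm T}) (s : strategy) : strategy :=
  Strategy (perm_strategy_subproof rho s).

End Strategy.
Arguments strategy : clear implicits.

Section PermAverage.
Context {R : realType} {A T : finType}.

Fact perm_average_subproof (s : {perm A} -> strategy R T)
    (p := [ffun a => ((#|A|)`!%:R)^-1 * \sum_(rho : {perm A}) s rho a]) :
  [forall a, 0 <= p a] && (\sum_a p a == 1).
Proof.
apply/andP; split.
  apply/forallP => a; rewrite ffunE mulr_ge0 ?invr_ge0 ?ler0n //.
  by apply: sumr_ge0 => rho _; exact: strategy_ge0.
under eq_bigr do rewrite ffunE.
rewrite -mulr_sumr exchange_big /=.
under eq_bigr do rewrite strategy_sum1.
have card_permT : #|{perm A}| = ((#|A|)`!)%N.
  rewrite -cardsT -card_perm; apply: eq_card => rho.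
  by rewrite inE [RHS]inE; apply/esym/fintype.subsetP => x; rewrite inE.
rewrite big_const iter_addr_0 card_permT mulVf ?eqxx // pnatr_eq0 -lt0n fact_gt0.
Qed.

Definition perm_average (s : {perm A} -> strategy R T) : strategy R T :=
  Strategy (perm_average_subproof s).

End PermAverage.

Section Payoff.
Context {R : realType} {m : player -> nat}.

Definition profile : finType := {dffun forall i : player, action m i}.

(* The profile (x, a_{-i}). *)
Definition update_action (a : profile) (i : player) (x : action m i) : profile :=
  finfun (dfwith (a : forall j : player, action m j) i x).

Record payoff := Payoff {
  payoff_val :> {ffun player -> {ffun profile -> R}};
  _ : [forall i, forall a, 0 <= payoff_val i a <= 1]
}.

HB.instance Definition _ := [isSub for payoff_val].
HB.instance Definition _ := [Choice of payoff by <:].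

Lemma payoff_bounds (u : payoff) i a : 0 <= u i a <= 1.
Proof. by have /forallP/(_ i)/forallP := valP u; exact. Qed.

Fact payoff0_subproof (u := [ffun _ : player => [ffun _ : profile => 0 : R]]) :
  [forall i, forall a, 0 <= u i a <= 1].
Proof. by do 2!apply/forallP => ?; rewrite !ffunE lexx ler01. Qed.

HB.instance Definition _ := isPointed.Build payoff (Payoff payoff0_subproof).

(* Borel sigma-algebra of [0,1]^(player * profile): it is generated by the
   coordinate functions u |-> u i a. *)
Definition payoff_cylinders : set (set payoff) :=
  [set C | exists i a (B : set R),
     measurable B /\ C = [set u : payoff | B (u i a)]]%classic.

HB.instance Definition _ := @isMeasurable.Build (sigma_display payoff_cylinders)
  payoff <<s payoff_cylinders >>%classic (@sigma_algebra0 _ setT payoff_cylinders)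
  (@sigma_algebraC _ payoff_cylinders)
  (@sigma_algebra_bigcup _ setT payoff_cylinders).

Fact perm_payoff_subproof (i : player) (rho : {perm action m i}) (u : payoff)
    (v := [ffun j => [ffun a : profile => u j (update_action a ((rho^-1)%g (a i)))]]) :
  [forall j, forall a, 0 <= v j a <= 1].
Proof. by do 2!apply/forallP => ?; rewrite !ffunE payoff_bounds. Qed.

Definition perm_payoff (i : player) (rho : {perm action m i}) (u : payoff) :
  payoff := Payoff (perm_payoff_subproof rho u).

Definition perm_invariant (D : probability payoff R) : Prop :=
  forall (i : player) (rho : {perm action m i}) (B : set payoff),
    measurable B -> pushforward D (perm_payoff rho) B = D B.

Definition strategy_profile := forall i : player, strategy R (action m i).

Definition update_strategy (s : strategy_profile) (i : player)
  (t : strategy R (action m i)) : strategy_profile := dfwith s i t.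

Definition mixed_payoff (u : payoff) (i : player) (s : strategy_profile) : R :=
  \sum_(a : profile) (\prod_j s j (a j)) * u i a.

Definition NE_approximation (s : strategy_profile) (u : payoff) : R :=
  finmax (fun i : player =>
    finmax (fun a : action m i => mixed_payoff u i (update_strategy s (pure_strategy a)))
    - mixed_payoff u i s).

(* Measurability into the product of simplices, with its Borel sigma-algebra,
   amounts to measurability of each coordinate. *)
Definition measurable_approximator (f : payoff -> strategy_profile) : Prop :=
  forall (i : player) (a : action m i), measurable_fun setT (fun u => f u i a).

Definition PPE (f : payoff -> strategy_profile) : Prop :=
  forall (i : player) (rho : {perm action m i}) (u : payoff),
    f (perm_payoff rho u) i = perm_strategy rho (f u i).

Definition orbit_average_player (i : player) (f : payoff -> strategy_profile) :
    payoff -> strategy_profile :=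
  fun u j => if j == i then f u j else
    perm_average (fun rho : {perm action m i} => f (perm_payoff rho u) j).

Definition orbit_average (f : payoff -> strategy_profile) :
    payoff -> strategy_profile :=
  orbit_average_player player1 (orbit_average_player player2 f).

End Payoff.
Arguments profile : clear implicits.
Arguments payoff : clear implicits.
Arguments strategy_profile : clear implicits.

(* Main.v *)
(* It suffices to treat one averaging step at a time, since O_i preserves PPE and
   measurability. Let f be PPE, i <> j, and let rho permute player i's actions.
   Equivariance makes f(rho u) equal to rho applied to (f(u)_i, f(rho u)_j), so
   by relabelling E(f(rho u), rho u) = E((f(u)_i, f(rho u)_j), u). The right-hand
   side is convex in player j's strategy, hence its average over rho is at least
   E((O_i f)(u), u). Integrating, each E(f(rho u), rho u) has the same
   expectation as E(f(u), u) by invariance of D. *)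
Require Import Defs.
From HB Require Import structures.
From mathcomp Require Import all_boot all_order all_algebra all_fingroup.
From mathcomp Require Import all_classical all_reals all_analysis.
From mathcomp Require Import measurable_realfun.

Set Implicit Arguments.
Unset Strict Implicit.
Unset Printing Implicit Defensive.

Local Open Scope ring_scope.

Import Order.TTheory GRing.Theory Num.Theory.

(** * Finite maxima *)

Section Finmax.
Context {R : realType} {n : nat}.

Lemma finmax_ge (F : 'I_n.+1 -> R) k : F k <= finmax F.
Proof. exact: le_bigmax. Qed.

Lemma finmax_le (F : 'I_n.+1 -> R) x : (forall k, F k <= x) -> finmax F <= x.
Proof. by move=> Fx; apply: bigmax_le. Qed.

(** The default [F ord0] of the maximum moves under relabelling, so the two maxima are compared
    through their bounds rather than by reindexing. *)
Lemma finmax_perm (rho : {perm 'I_n.+1}) (F : 'I_n.+1 -> R) :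
  finmax (fun k => F (rho k)) = finmax F.
Proof.
apply/eqP; rewrite eq_le; apply/andP; split; apply: finmax_le => k.
  exact: (finmax_ge F).
by rewrite -[k](permKV rho); exact: (finmax_ge (fun k => F (rho k))).
Qed.

Lemma measurable_finmax d (T : measurableType d) (F : T -> 'I_n.+1 -> R) :
  (forall k, measurable_fun setT (F^~ k)) ->
  measurable_fun setT (fun x => finmax (F x)).
Proof.
move=> mF; rewrite /finmax.
under eq_fun do rewrite unlock.
(* On the empty list the fold returns the default, the coordinate at [ord0]. *)
elim: (index_enum _) => [|k r IH] /=; first exact: mF.
exact: measurable_maxr.
Qed.

End Finmax.

(** * Permutation averages and relabelled strategies *)

Lemma card_perm_type (A : finType) : #|{perm A}| = (#|A|)`!.
Proof.
rewrite -cardsT -card_perm; apply: eq_card => rho.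
by rewrite inE [RHS]inE; apply/esym/fintype.subsetP => x; rewrite inE.
Qed.

Lemma perm_mean_const (R : realType) (A : finType) (c : R) :
  ((#|A|)`!%:R)^-1 * \sum_(rho : {perm A}) c = c.
Proof.
rewrite sumr_const card_perm_type -[c *+ _]mulr_natl mulKf //.
Qed.

Section Strategies.
Context {R : realType} {T : finType}.
Implicit Types s : strategy R T.

Lemma strategyP s1 s2 : s1 =1 s2 -> s1 = s2.
Proof. by move=> s12; apply/val_inj/ffunP. Qed.

Lemma perm_pure_strategy (rho : {perm T}) b :
  perm_strategy rho (pure_strategy b) = pure_strategy (rho b) :> strategy R T.
Proof. by apply: strategyP => a; rewrite !ffunE (canF_eq (permKV rho)). Qed.

End Strategies.

(** * Multilinearity of payoffs and convexity of the approximation *)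

Section Games.
Context {R : realType} {m : player -> nat}.
Implicit Types (u : payoff R m) (s : strategy_profile R m) (i j k : player).

Lemma update_strategy_same s i t : update_strategy (i := i) s t i = t.
Proof. exact: dfwithin. Qed.

Lemma update_strategy_other s i j t : i != j ->
  update_strategy (i := i) s t j = s j.
Proof. by move=> ij; exact: dfwithout. Qed.

Lemma strategy_profileP s1 s2 : (forall i, s1 i = s2 i) -> s1 = s2.
Proof. by move=> s12; exact: functional_extensionality_dep. Qed.

Lemma update_strategy_id s i : update_strategy (i := i) s (s i) = s.
Proof.
apply: strategy_profileP => j; have [<-|ij] := eqVneq i j.
  by rewrite update_strategy_same.
by rewrite update_strategy_other.
Qed.

Lemma update_strategy_twice s i t t' :
  update_strategy (i := i) (update_strategy (i := i) s t) t' =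
  update_strategy (i := i) s t'.
Proof.
apply: strategy_profileP => j; have [<-|ij] := eqVneq i j.
  by rewrite !update_strategy_same.
by rewrite !update_strategy_other.
Qed.

Lemma update_strategyC s i j t t' : i != j ->
  update_strategy (i := j) (update_strategy (i := i) s t) t' =
  update_strategy (i := i) (update_strategy (i := j) s t') t.
Proof.
move=> ij; apply: strategy_profileP => k; have [<-|ik] := eqVneq i k.
  by rewrite update_strategy_same update_strategy_other 1?eq_sym //
             update_strategy_same.
rewrite [RHS]update_strategy_other //; have [<-|jk] := eqVneq j k.
  by rewrite !update_strategy_same.
by rewrite !update_strategy_other.
Qed.

(** Multilinearity: player [j] contributes the single factor [t (a j)] to each product, so expected
    payoffs are linear in that player's strategy. *)
Lemma mixed_payoff_update u k s j t :
  mixed_payoff u k (update_strategy (i := j) s t) =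
  \sum_b t b * mixed_payoff u k (update_strategy (i := j) s (pure_strategy b)).
Proof.
under [RHS]eq_bigr do rewrite mulr_sumr.
rewrite exchange_big /=; apply: eq_bigr => a _.
have prodE t' : \prod_i update_strategy (i := j) s t' i (a i) =
    t' (a j) * \prod_(i | i != j) s i (a i).
  rewrite (bigD1 j) //= update_strategy_same; congr (_ * _).
  by apply: eq_bigr => i ij; rewrite update_strategy_other // eq_sym.
under [RHS]eq_bigr do rewrite prodE ffunE.
(* The pure strategy at [b] gives [a j] weight zero unless [b = a j], so one term survives. *)
rewrite prodE (bigD1 (a j)) //= eqxx mul1r.
rewrite [X in _ = _ + X]big1 ?addr0 ?mulrA // => b ba.
by rewrite eq_sym (negbTE ba) !mul0r mulr0.
Qed.

Lemma mixed_payoff_average (A : finType) u k s j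
    (t : {perm A} -> strategy R 'I_(m j).+1) :
  mixed_payoff u k (update_strategy (i := j) s (perm_average t)) =
  ((#|A|)`!%:R)^-1 * \sum_rho mixed_payoff u k (update_strategy (i := j) s (t rho)).
Proof.
under [in RHS]eq_bigr do rewrite mixed_payoff_update.
rewrite mixed_payoff_update exchange_big /= mulr_sumr.
by apply: eq_bigr => b _; rewrite ffunE -mulrA mulr_suml.
Qed.

(** A mean over pure actions is at most their maximum, so already the regret of player [ord0] is
    nonnegative. This later allows integration without integrability conditions. *)
Lemma NE_approximation_ge0 s u : 0 <= NE_approximation s u.
Proof.
apply: le_trans (finmax_ge _ ord0); rewrite subr_ge0.
rewrite -[X in mixed_payoff u _ X](update_strategy_id s ord0).
set F := fun a => mixed_payoff u ord0 (update_strategy (i := ord0) s (pure_strategy a)).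
rewrite mixed_payoff_update -[finmax F]mul1r -(strategy_sum1 (s ord0)) mulr_suml.
by apply: ler_sum => b _; rewrite ler_wpM2l ?strategy_ge0 // (finmax_ge F).
Qed.

(* Once the other player's strategy is fixed, every regret is a maximum of affine
   functions of one player's strategy. *)
Lemma NE_approximation_average (A : finType) u s j
    (t : {perm A} -> strategy R 'I_(m j).+1) :
  NE_approximation (update_strategy (i := j) s (perm_average t)) u <=
  ((#|A|)`!%:R)^-1 * \sum_rho NE_approximation (update_strategy (i := j) s (t rho)) u.
Proof.
apply: finmax_le => k; rewrite lerBlDr; apply: finmax_le => p.
have -> : mixed_payoff u k
      (update_strategy (i := k) (update_strategy (i := j) s (perm_average t)) (pure_strategy p)) =
    ((#|A|)`!%:R)^-1 * \sum_rho mixed_payoff u k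
      (update_strategy (i := k) (update_strategy (i := j) s (t rho)) (pure_strategy p)).
  have [jk|jk] := eqVneq j k.
    (* A deviation by [j] overwrites the averaged strategy, so its payoff is constant in [rho]. *)
    case: _ / jk in p *; rewrite update_strategy_twice.
    under eq_bigr do rewrite update_strategy_twice.
    by rewrite perm_mean_const.
  (* For distinct players the two updates commute, and linearity in the averaged strategy
     applies. *)
  rewrite update_strategyC // mixed_payoff_average.
  by under eq_bigr do rewrite update_strategyC 1?eq_sym //.
rewrite mixed_payoff_average -mulrDr ler_wpM2l ?invr_ge0 ?ler0n //.
rewrite -big_split /=; apply: ler_sum => rho _; rewrite -lerBlDr.
set s' := update_strategy s _.
apply: le_trans (finmax_ge _ k); rewrite lerD2r.
exact: (finmax_ge (fun a => mixed_payoff u k (update_strategy (i := k) s' (pure_strategy a)))).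
Qed.


(** * Relabelling one player's actions *)

Lemma update_action_same (a : profile m) i x : update_action (i := i) a x i = x.
Proof. by rewrite ffunE dfwithin. Qed.

Lemma update_action_other (a : profile m) i j x : i != j ->
  update_action (i := i) a x j = a j.
Proof. by move=> ij; rewrite ffunE dfwithout. Qed.

Lemma payoffP u (v : payoff R m) : (forall k a, u k a = v k a) -> u = v.
Proof. by move=> uv; apply/val_inj/ffunP => k; apply/ffunP => a; exact: uv. Qed.

Lemma perm_payoffE i (rho : {perm 'I_(m i).+1}) u j a :
  perm_payoff rho u j a = u j (update_action a ((rho^-1)%g (a i))).
Proof. by rewrite !ffunE. Qed.

Lemma mixed_payoff_perm u k s i (rho : {perm 'I_(m i).+1}) :
  mixed_payoff (perm_payoff rho u) k
    (update_strategy (i := i) s (perm_strategy rho (s i))) =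
  mixed_payoff u k s.
Proof.
(* [h r] lifts a permutation of the actions of [i] to profiles. Inverse permutations lift to inverse
   maps, which justifies the change of variables in the sum. *)
pose h (r : {perm 'I_(m i).+1}) (a : profile m) := update_action a (r (a i)).
have hK (r r' : {perm 'I_(m i).+1}) : cancel r r' -> cancel (h r) (h r').
  move=> rK a; apply/ffunP => j; have [<-|ij] := eqVneq i j.
    by rewrite /h !update_action_same rK.
  by rewrite /h !update_action_other.
rewrite /mixed_payoff (reindex_inj (can_inj (hK _ _ (permK rho)))).
apply: eq_bigr => a _; rewrite perm_payoffE.
have -> : update_action (h rho a) ((rho^-1)%g (h rho a i)) = a.
  exact: (hK _ _ (permK rho)).
congr (_ * _); apply: eq_bigr => j _; have [<-|ij] := eqVneq i j.
  by rewrite update_strategy_same ffunE update_action_same permK.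
by rewrite update_strategy_other // update_action_other.
Qed.

Lemma NE_approximation_perm s u i (rho : {perm 'I_(m i).+1}) :
  NE_approximation (update_strategy (i := i) s (perm_strategy rho (s i)))
    (perm_payoff rho u) = NE_approximation s u.
Proof.
congr finmax; apply/funext => k; rewrite mixed_payoff_perm; congr (_ - _).
have [ik|ik] := eqVneq i k; last first.
  (* A deviation by another player commutes with relabelling [i], so its payoff is preserved. *)
  congr finmax; apply/funext => a; rewrite update_strategyC //.
  rewrite -(mixed_payoff_perm u k _ rho) update_strategy_other 1?eq_sym //.
case: _ / ik.
(* Deviating to [a] corresponds to deviating to [rho a] in the relabelled game, so the maximum over
   deviations is reindexed by [rho]. *)
rewrite -(finmax_perm rho); congr finmax; apply/funext => a.
rewrite -(mixed_payoff_perm u i _ rho) update_strategy_same !update_strategy_twice.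
by rewrite perm_pure_strategy.
Qed.

Lemma perm_payoffC u i j (rho : {perm 'I_(m i).+1}) (tau : {perm 'I_(m j).+1}) :
  i != j ->
  perm_payoff rho (perm_payoff tau u) = perm_payoff tau (perm_payoff rho u).
Proof.
move=> ij; apply: payoffP => k a.
rewrite !perm_payoffE; congr (u k _); apply/ffunP => l.
have [<-|il] := eqVneq i l.
  rewrite update_action_other 1?eq_sym // !update_action_same.
  by rewrite update_action_other 1?eq_sym.
rewrite [RHS]update_action_other //; have [<-|jl] := eqVneq j l.
  by rewrite !update_action_same update_action_other.
by rewrite !update_action_other.
Qed.

(** * Measurability of relabelling and of the approximation *)

Lemma payoff_coordinate_measurable k a :
  measurable_fun setT (fun u : payoff R m => u k a).
Proof.
move=> _ B mB; rewrite setTI; apply: sub_gen_smallest.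
by exists k, a, B.
Qed.

Lemma perm_payoff_measurable i (rho : {perm 'I_(m i).+1}) :
  measurable_fun setT (perm_payoff (R := R) rho).
Proof.
apply: (measurability (@payoff_cylinders R m)) => // _ [_ [k [a [B [mB ->]]]] <-].
rewrite setTI; apply: sub_gen_smallest.
exists k, (update_action a ((rho^-1)%g (a i))), B; split=> //.
by apply/funext => u; rewrite /preimage /= perm_payoffE.
Qed.

Implicit Types f : payoff R m -> strategy_profile R m.

Lemma mixed_payoff_measurable f k : measurable_approximator f ->
  measurable_fun setT (fun u => mixed_payoff u k (f u)).
Proof.
move=> mf; apply: measurable_sum => a; apply: measurable_funM.
  by apply: measurable_prod => j _; exact: mf.
exact: payoff_coordinate_measurable.
Qed.

Lemma measurable_update_strategy f i (t : payoff R m -> strategy R 'I_(m i).+1) :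
  measurable_approximator f ->
  (forall a, measurable_fun setT (t^~ a)) ->
  measurable_approximator (fun u => update_strategy (f u) (t u)).
Proof.
move=> mf mt j; have [<-|ij] := eqVneq i j => a.
  by under eq_fun do rewrite update_strategy_same; exact: mt.
by under eq_fun do rewrite update_strategy_other //; exact: mf.
Qed.

Lemma NE_approximation_measurable f : measurable_approximator f ->
  measurable_fun setT (fun u => NE_approximation (f u) u).
Proof.
move=> mf; apply: measurable_finmax => k; apply: measurable_funB; last first.
  exact: mixed_payoff_measurable.
apply: measurable_finmax => a.
apply: (@mixed_payoff_measurable
  (fun u => update_strategy (f u) (pure_strategy a))).
apply: measurable_update_strategy => // b; exact: measurable_cst.
Qed.

(** * The averaging step and what it preserves *)

Lemma other_player i j k : i != j -> k != i -> k = j.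
Proof.
by move: i j k => [[|[]]//] ? [[|[]]//] ? [[|[]]//] ? // _ _; exact: val_inj.
Qed.

(** With two players only one strategy is averaged, so the step is a single update and convexity in
    that strategy applies. *)
Lemma orbit_average_playerE i j f u : i != j ->
  orbit_average_player i f u =
  update_strategy (f u)
    (perm_average (fun rho : {perm 'I_(m i).+1} => f (perm_payoff rho u) j)).
Proof.
move=> ij; apply: strategy_profileP => k; rewrite /orbit_average_player.
have [->|ki] := eqVneq k i; first by rewrite update_strategy_other 1?eq_sym.
rewrite (other_player ij ki).
by rewrite update_strategy_same.
Qed.

Lemma orbit_average_player_measurable i f : measurable_approximator f ->
  measurable_approximator (orbit_average_player i f).
Proof.
move=> mf j a; rewrite /orbit_average_player; have [ji|ji] := eqVneq j i.
  exact: mf.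
under eq_fun do rewrite ffunE.
apply: measurable_funM; first exact: measurable_cst.
apply: measurable_sum => rho.
exact: (measurableT_comp (mf j a) (perm_payoff_measurable rho)).
Qed.

(** For [j] other than [i], [tau] commutes with every [rho] in the average, so equivariance of [f]
    applies term by term. *)
Lemma orbit_average_player_PPE i f : PPE f -> PPE (orbit_average_player i f).
Proof.
move=> fP j tau u; rewrite /orbit_average_player; have [ji|ji] := eqVneq j i.
  exact: fP.
apply: strategyP => a; rewrite !ffunE; congr (_ * _).
by apply: eq_bigr => rho _; rewrite perm_payoffC 1?eq_sym // fP ffunE.
Qed.

Lemma NE_approximation_orbit_average_player i j f u : i != j -> PPE f ->
  NE_approximation (orbit_average_player i f u) u <=
  ((#|'I_(m i).+1|)`!%:R)^-1 * \sum_(rho : {perm 'I_(m i).+1})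
    NE_approximation (f (perm_payoff rho u)) (perm_payoff rho u).
Proof.
move=> ij fP; rewrite (orbit_average_playerE _ _ ij).
apply: le_trans (NE_approximation_average _ _ _) _.
(* Convexity gave the only inequality; the two averages now agree term by term, by relabelling the
   game with [rho]. *)
rewrite le_eqVlt; apply/orP; left; apply/eqP; congr (_ * _).
apply: eq_bigr => rho _; rewrite -(NE_approximation_perm _ _ rho).
congr NE_approximation; apply: strategy_profileP => k.
have [<-|ik] := eqVneq i k.
  by rewrite update_strategy_same update_strategy_other 1?eq_sym // fP.
rewrite update_strategy_other //.
have -> : k = j by apply: (other_player ij); rewrite eq_sym.
by rewrite update_strategy_same.
Qed.

(** * Expectations under an invariant distribution *)

Lemma expectation_perm_payoff (D : probability (payoff R m) R) i
    (rho : {perm 'I_(m i).+1}) (X : payoff R m -> R) :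
  perm_invariant D -> measurable_fun setT X -> (forall u, 0 <= X u) ->
  ('E_D[fun u => X (perm_payoff rho u)] = 'E_D[X])%E.
Proof.
move=> DP mX X0; rewrite unlock; symmetry.
have mp := perm_payoff_measurable rho.
(* Invariance replaces [D] by its pushforward, and the change of variables formula does the rest. *)
rewrite -(@eq_measure_integral _ _ _ _ D (pushforward D (perm_payoff rho))).
  rewrite ge0_integral_pushforward //.
  - exact/measurable_EFinP.
  - by move=> u _; rewrite lee_fin.
by move=> B mB _; exact: DP.
Qed.

(** Nonnegativity lets the sum and the scalar leave the integral even for infinite values. *)
Lemma expectation_perm_mean (D : probability (payoff R m) R) (A : finType)
    (X : {perm A} -> payoff R m -> R) :
  (forall rho, measurable_fun setT (X rho)) -> (forall rho u, 0 <= X rho u) ->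
  ('E_D[fun u => (((#|A|)`!%:R)^-1 * \sum_rho X rho u)%R] =
   (((#|A|)`!%:R)^-1%R)%:E * \sum_rho 'E_D[X rho])%E.
Proof.
move=> mX X0; rewrite [in LHS]unlock.
under eq_integral do rewrite EFinM -sumEFin.
rewrite ge0_integralZl //.
- rewrite ge0_integral_sum //.
  + by congr (_ * _)%E; apply: eq_bigr => rho _; rewrite unlock.
  + by move=> rho; exact/measurable_EFinP.
  + by move=> rho u _; rewrite lee_fin.
- apply: (@emeasurable_sum _ _ _ _ _ _ (fun rho u => (X rho u)%:E)) => rho.
  exact/measurable_EFinP.
- by move=> u _; apply: sume_ge0 => rho _; rewrite lee_fin.
Qed.

Lemma expectation_orbit_average_player (D : probability (payoff R m) R) i j f :
  i != j -> perm_invariant D -> measurable_approximator f -> PPE f ->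
  ('E_D[fun u => NE_approximation (orbit_average_player i f u) u]
     <= 'E_D[fun u => NE_approximation (f u) u])%E.
Proof.
move=> ij DP mf fP.
have mN := NE_approximation_measurable mf.
pose X (rho : {perm 'I_(m i).+1}) u :=
  NE_approximation (f (perm_payoff rho u)) (perm_payoff rho u).
have mX rho : measurable_fun setT (X rho).
  exact: (measurableT_comp mN (perm_payoff_measurable rho)).
have X0 rho u : 0 <= X rho u by exact: NE_approximation_ge0.
have EX rho : ('E_D[X rho] = 'E_D[fun u => NE_approximation (f u) u])%E.
  by apply: expectation_perm_payoff => // u; exact: NE_approximation_ge0.
apply: (@le_trans _ _ ('E_D[fun u =>
    (((#|'I_(m i).+1|)`!%:R)^-1 * \sum_rho X rho u)%R])%E).
  apply: expectation_le.
  - exact: (NE_approximation_measurable (@orbit_average_player_measurable i f mf)).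
  - apply: measurable_funM; first exact: measurable_cst.
    exact: measurable_sum.
  - by move=> u; exact: NE_approximation_ge0.
  - by move=> u; rewrite mulr_ge0 ?invr_ge0 ?ler0n // sumr_ge0.
  - by apply: aeW => u; exact: (NE_approximation_orbit_average_player u ij fP).
rewrite expectation_perm_mean //; under eq_bigr do rewrite EX.
(* The summands no longer depend on [rho]; the mean formula read backwards for a constant family
   collapses them to one expectation. *)
rewrite -expectation_perm_mean //; last by move=> _ u; exact: NE_approximation_ge0.
by under eq_fun do rewrite perm_mean_const.
Qed.

End Games.

Theorem theorem4p9 (R : realType) (m : player -> nat)
    (D : probability (payoff R m) R) (f : payoff R m -> strategy_profile R m)
    (D_invariant : perm_invariant D)
    (f_measurable : measurable_approximator f) (f_PPE : PPE f) :
  ('E_D[fun u => NE_approximation (orbit_average f u) u]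
     <= 'E_D[fun u => NE_approximation (f u) u])%E.
Proof.
(* The inner average over player 2's permutations is compared with [f] first; the outer step then
   takes this average as its approximator. *)
apply: le_trans (expectation_orbit_average_player
  (i := player2) (j := player1) _ _ _ _) => //.
apply: (expectation_orbit_average_player (j := player2)) => //.
  exact: orbit_average_player_measurable.
exact: orbit_average_player_PPE.
Qed.
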